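(* Let $\mathscr{W}_F(F_1,\dots,F_d)$ be the implicit $d$-web associated with $F$ on an open set $U\subset\mathbb{C}^2$, with slopes $p_i=-\dfrac{\partial_x F_i}{\partial_y F_i}$, $i=1,\dots,d$. Let $G$ be a symmetry group of $\mathscr{W}_F(F_1,\dots,F_d)$. Then every infinitesimal generator $X=\alpha_1(x,y)\,\partial_x+\alpha_2(x,y)\,\partial_y$ of $G$ satisfies, for every $i=1,\dots,d$, $$-\alpha_1\,\partial_x(p_i)-\alpha_2\,\partial_y(p_i)+\partial_x(\alpha_2)+\bigl(\partial_y(\alpha_2)-\partial_x(\alpha_1)\bigr)p_i-\partial_y(\alpha_1)\,p_i^2=0 .$$
   Context: Let $F(x,y,y')=a_0(x,y)(y')^d+a_1(x,y)(y')^{d-1}+\cdots+a_d(x,y)=0$, $y'=dy/dx$, be a first-order differential equation, polynomial of degree $d$ in $y'$, with analytic coefficients $a_i$, and let $P_F(z;x,y)=a_0z^d+a_1z^{d-1}+\cdots+a_d$ be its presentation polynomial. One works on an open set $U\subset\mathbb{C}^2$ on which the $z$-resultant of $P_F$ and $\partial_zP_F$ does not vanish (factorization condition) and on which $P_F$ factors as $a_0\prod_{i=1}^d(z-p_i(x,y))$ with $p_1,\dots,p_d$ analytic (and pairwise distinct at every point). The implicit $d$-web $\mathscr{W}_F(F_1,\dots,F_d)$ is the family of the $d$ foliations of $U$ whose leaves are the integral curves of $y'=p_i(x,y)$, $i=1,\dots,d$; here $F_i$ also denotes an analytic function with $\partial_yF_i\neq0$ whose level sets are the leaves of the $i$-th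 foliation, so that $p_i=-\partial_xF_i/\partial_yF_i$. A symmetry group $G$ of the web is a local group of analytic transformations $g_\varepsilon$ of $U$ depending on a parameter $\varepsilon$, with $g_0=\mathrm{id}$, which leaves the web globally invariant (leaves of the web are mapped to leaves of the web). Its infinitesimal generator is the vector field $X=\frac{d}{d\varepsilon}\big|_{\varepsilon=0}g_\varepsilon=\alpha_1\partial_x+\alpha_2\partial_y$, with $\alpha_1,\alpha_2$ analytic. *)

(* Defs.v *)
From HB Require Import structures.
From Stdlib Require Import Relation_Operators.
From mathcomp Require Import all_boot all_order all_algebra.
From mathcomp Require Import all_classical all_reals all_analysis.
From mathcomp Require Import complex.
Set Implicit Arguments.
Unset Strict Implicit.
Unset Printing Implicit Defensive.
Import Order.TTheory GRing.Theory Num.Theory.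
Import numFieldNormedType.Exports.
Local Open Scope classical_set_scope.
Local Open Scope ring_scope.

(* R[i] packed as a numClosedFieldType: this is what gives it the norm, the
   topology and the complex derivative that MathComp-Analysis attaches to every
   numClosedFieldType. Norms are (real) elements of the field itself. *)
Definition Cplx (R : realType) : numClosedFieldType := R[i].

Section ImplicitWebs.
Variable C : numClosedFieldType.
Implicit Types (A U : set (C * C)) (D : set (C * (C * C))) (q : C * C).

Definition d_x (f : C * C -> C) q : C := 'D_((1, 0) : C * C) f q.
Definition d_y (f : C * C -> C) q : C := 'D_((0, 1) : C * C) f q.

(* Near each point of A, and at the points of A, f is the sum of a power series
   that converges absolutely on a closed polydisc. *)
Definition analytic2_on A (f : C * C -> C) : Prop :=
  forall a, A a -> exists (r : C) (c : nat -> nat -> C),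
    [/\ 0 < r,
        exists M : C, forall N : nat,
          \sum_(i < N) \sum_(j < N) `|c i j| * r ^+ (i + j) <= M
      & forall z, A z -> `|z.1 - a.1| < r -> `|z.2 - a.2| < r ->
          (fun N : nat => \sum_(i < N) \sum_(j < N)
             c i j * (z.1 - a.1) ^+ i * (z.2 - a.2) ^+ j) @ \oo --> f z].

(* Same in three variables. For D relatively open in (real line) x C^2 this says:
   jointly analytic, real in the first variable and complex in the others. *)
Definition analytic3_on D (f : C * (C * C) -> C) : Prop :=
  forall a, D a -> exists (r : C) (c : nat -> nat -> nat -> C),
    [/\ 0 < r,
        exists M : C, forall N : nat,
          \sum_(i < N) \sum_(j < N) \sum_(k < N)
             `|c i j k| * r ^+ (i + j + k) <= M
      & forall z, D z -> `|z.1 - a.1| < r ->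
          `|z.2.1 - a.2.1| < r -> `|z.2.2 - a.2.2| < r ->
          (fun N : nat => \sum_(i < N) \sum_(j < N) \sum_(k < N)
             c i j k * (z.1 - a.1) ^+ i * (z.2.1 - a.2.1) ^+ j
                     * (z.2.2 - a.2.2) ^+ k) @ \oo --> f z].

Definition presentation_poly d (a : 'I_d.+1 -> C * C -> C) q : {poly C} :=
  \sum_(k < d.+1) a k q *: 'X^(d - k).

(* The z-resultant is that of polynomials of formal degrees d and d - 1: it
   vanishes where a_0 does. MathComp's resultant uses the actual degrees, and
   coincides with it where a_0 <> 0, whence the first conjunct. *)
Definition factorization_condition d U (a : 'I_d.+1 -> C * C -> C) : Prop :=
  forall q, U q ->
    a ord0 q != 0 /\
    resultant (presentation_poly a q) (deriv (presentation_poly a q)) != 0.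

(* The graph over a disc of a solution of y' = p(x, y). *)
Definition integral_curve A (p : C * C -> C) (c r : C) (u : C -> C) : Prop :=
  forall t, ball c r t -> A (t, u t) /\ is_derive t (1 : C) u (p (t, u t)).

Definition on_integral_curve A (p : C * C -> C) q q' : Prop :=
  exists (c r : C) (u : C -> C),
    [/\ integral_curve A p c r u, ball c r q.1, ball c r q'.1,
        q.2 = u q.1 & q'.2 = u q'.1].

(* The maximal integral curve in A through q, for q in A. It is obtained by
   gluing local solutions and need not be a graph over a domain of the x-axis. *)
Definition leaf A (p : C * C -> C) q : set (C * C) :=
  [set q' | clos_refl_trans (C * C)%type (on_integral_curve A p) q q'].

(* F is the defining function of the foliation of U by the curves y' = p. *)
Record foliation_function U (p F : C * C -> C) : Prop := FoliationFunction {
  foliation_analytic : analytic2_on U F;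
  foliation_d_y : forall q, U q -> d_y F q != 0;
  foliation_slope : forall q, U q -> p q = - (d_x F q / d_y F q);
  foliation_level : forall q, U q ->
    [set q' | U q' /\ F q' = F q] = leaf U p q
}.

(* The implicit d-web W_F(F_1, ..., F_d) on U of the equation
   a_0 y'^d + a_1 y'^(d-1) + ... + a_d = 0, with slopes p_1, ..., p_d. *)
Record implicit_web d U (a : 'I_d.+1 -> C * C -> C) (p F : 'I_d -> C * C -> C)
    : Prop := ImplicitWeb {
  web_open : open U;
  web_coef_analytic : forall k, analytic2_on U (a k);
  web_factorization : factorization_condition U a;
  web_slope_analytic : forall i, analytic2_on U (p i);
  web_slope_distinct : forall i j, i != j -> forall q, U q -> p i q != p j q;
  web_factor : forall q, U q ->
    presentation_poly a q = a ord0 q *: \prod_(i < d) ('X - (p i q)%:P);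
  web_foliation : forall i, foliation_function U (p i) (F i)
}.

(* The group parameter may be complex or real. *)
Definition parameter_line (K : set C) : Prop :=
  K = setT \/ K = [set e | e \is Num.real].

Definition domain_at D (e : C) : set (C * C) := [set q | D (e, q)].

(* One-parameter local group of analytic transformations of U with additive
   parameter in K; D is the set of (e, q) such that g_e is defined at q. Only the
   values of g on D matter. *)
Record local_group (K : set C) U D (g : C -> C * C -> C * C) : Prop := LocalGroup {
  lgroup_sub : forall e q, D (e, q) -> K e /\ U q;
  lgroup_open : forall z, D z -> \forall z' \near z, K z'.1 -> D z';
  lgroup_dom0 : forall q, U q -> D (0, q);
  lgroup_range : forall e q, D (e, q) -> U (g e q);
  lgroup_id : forall q, U q -> g 0 q = q;
  lgroup_comp : forall e s q, D (s, q) -> D (e, g s q) -> D (e + s, q) ->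
    g e (g s q) = g (e + s) q;
  lgroup_inv : forall e q, D (e, q) ->
    D (- e, g e q) /\ g (- e) (g e q) = q;
  lgroup_analytic1 : analytic3_on D (fun z => (g z.1 z.2).1);
  lgroup_analytic2 : analytic3_on D (fun z => (g z.1 z.2).2)
}.

(* By lgroup_inv, g_e maps its domain bijectively onto the domain of g_(-e). It
   must send each leaf of the web induced on the former to a leaf of the web
   induced on the latter; the foliations may be permuted. *)
Definition preserves_web d D (g : C -> C * C -> C * C) (p : 'I_d -> C * C -> C)
    : Prop :=
  forall e q (i : 'I_d), D (e, q) -> exists j : 'I_d,
    g e @` leaf (domain_at D e) (p i) q
      = leaf (domain_at D (- e)) (p j) (g e q).

Definition symmetry_group d (K : set C) U D (g : C -> C * C -> C * C)
    (p : 'I_d -> C * C -> C) : Prop :=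
  local_group K U D g /\ preserves_web D g p.

(* alpha1 d_x + alpha2 d_y = d/de g_e at e = 0, with e in K. *)
Record infinitesimal_generator (K : set C) U (g : C -> C * C -> C * C)
    (alpha1 alpha2 : C * C -> C) : Prop := InfinitesimalGenerator {
  generator_analytic1 : analytic2_on U alpha1;
  generator_analytic2 : analytic2_on U alpha2;
  generator_derivative : forall q, U q ->
    (fun e : C => e^-1 *: (g e q - q)) @ within K ((0 : C)^')
      --> (alpha1 q, alpha2 q)
}.

End ImplicitWebs.

(* Main.v *)
Require Import Defs.
From Stdlib Require Import Relation_Operators.
From mathcomp Require Import all_boot all_order all_algebra.
From mathcomp Require Import ring.
From mathcomp Require Import complex.
From mathcomp Require Import all_classical all_reals all_analysis.
Import Order.TTheory GRing.Theory Num.Theory.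
Import numFieldNormedType.Exports.
Local Open Scope classical_set_scope.
Local Open Scope ring_scope.

(** Fix a point [q] and a foliation [i], put [w = (1, p_i q)], and let
    [V(e) = (V_1(e), V_2(e))] be the image of [w] under the differential of
    [g_e] at [q]. The curve through [q] tangent to [w] lies in a leaf, and [g_e]
    sends it into a level set of some [F_j]; differentiating [F_j] along the image
    gives [V_2(e) = p_j(g_e q) V_1(e)] ([transported_slope]). As [e] tends to [0],
    [V(e)] tends to [w] and [p_j(g_e q)] to [p_j q]; the slopes at [q] are
    distinct and finitely many, so [j = i] for small [e]. The identity
    [V_2(e) = p_i(g_e q) V_1(e)] is then differentiated at [e = 0] along the
    parameter line: the derivative of [V_m] is the derivative of [alpha_m] in the
    direction [w], and that of [p_i(g_e q)] is
    [alpha_1 d_x p_i + alpha_2 d_y p_i]. This is the determining equation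
    ([determining_equation]).

    Three analytic facts support this argument. A sum of a power series is
    strictly differentiable at the centre ([analytic2_strict]), which yields the
    chain rule along curves ([analytic2_chain]). The derivatives in [e] and in the
    space variables commute at [e = 0] ([mixed_derivative]); this is read off from
    a bound on a mixed second difference of a power series in three variables
    ([analytic3_mixed_coef]). Finally, leaves are not reduced to points: a level
    set of a function with nonzero [y]-derivative has no isolated point
    ([level_set_not_isolated], Newton iteration in the complete field of complex
    numbers), so a leaf contains a point other than [q], and the first step of a
    chain of integral curves leading to it is an integral curve through [q]
    ([integral_curve_through]). *)

Section Web.
Set Implicit Arguments.
Unset Strict Implicit.
Unset Printing Implicit Defensive.

(** * Power series: termwise estimates *)

Section PowerSeries.
Variable C : numClosedFieldType.
Implicit Types (A : set (C * C)) (f : C * C -> C) (a q z v : C * C).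

(** The order of [C] is only partial, so the inequality is passed to the limit as
    the equality of [b - |u|] with its own norm. *)
Lemma norm_lim_le {T : Type} {G : set_system T} {FG : ProperFilter G}
    (u b : T -> C) (l B : C) :
  u @ G --> l -> b @ G --> B -> (\forall t \near G, `|u t| <= b t) -> `|l| <= B.
Proof.
move=> ul bB ub.
have n0 : (fun t => b t - `|u t|) @ G --> B - `|l|.
  by apply: cvgB => //; exact: cvg_norm.
have n1 : (fun t => b t - `|u t|) @ G --> `|B - `|l| |.
  apply: cvg_trans (cvg_norm n0); apply: near_eq_cvg.
  by apply: filterS ub => t ut; rewrite /= ger0_norm // subr_ge0.
by rewrite -subr_ge0 (cvg_unique (@norm_hausdorff _ C) n0 n1).
Qed.

Lemma normrXB_le (x y rho : C) n : `|x| <= rho -> `|y| <= rho ->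
  `|x ^+ n - y ^+ n| <= n%:R * rho ^+ n.-1 * `|x - y|.
Proof.
move=> xr yr; rewrite subrXX normrM mulrC ler_wpM2r //.
apply: (le_trans (ler_norm_sum _ _ _)).
have -> : n%:R * rho ^+ n.-1 = \sum_(i < n) rho ^+ n.-1.
  by rewrite sumr_const card_ord mulr_natl.
apply: ler_sum => i _.
have -> : rho ^+ n.-1 = rho ^+ (n.-1 - i) * rho ^+ i.
  by rewrite -exprD subnK //; case: n i => [|n] [i ?].
rewrite normrM !normrX.
have r0 := le_trans (normr_ge0 _) xr.
by apply: ler_pM; rewrite ?exprn_ge0 ?lerXn2r ?nnegrE.
Qed.

Lemma monomialB_le (x y : C * C) (rho eta : C) i j :
  `|x.1| <= rho -> `|x.2| <= rho -> `|y.1| <= rho -> `|y.2| <= rho ->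
  `|x.1 - y.1| <= eta -> `|x.2 - y.2| <= eta ->
  `|x.1 ^+ i * x.2 ^+ j - y.1 ^+ i * y.2 ^+ j|
    <= (i + j)%:R * rho ^+ (i + j).-1 * eta.
Proof.
move=> x1 x2 y1 y2 e1 e2; have r0 := le_trans (normr_ge0 _) x1.
have -> : x.1 ^+ i * x.2 ^+ j - y.1 ^+ i * y.2 ^+ j =
   (x.1 ^+ i - y.1 ^+ i) * x.2 ^+ j + y.1 ^+ i * (x.2 ^+ j - y.2 ^+ j).
  by rewrite mulrBl mulrBr addrA subrK.
apply: (le_trans (ler_normD _ _)).
rewrite natrD (mulrDl i%:R) (mulrDl (_ * _) _ eta); apply: lerD.
  rewrite normrM; case: i => [|i]; first by rewrite !expr0 subrr normr0 !mul0r.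
  have -> : (i.+1 + j).-1 = (i + j)%N by [].
  rewrite exprD mulrA -mulrA (mulrC (rho ^+ j)) mulrA.
  apply: ler_pM => //; last by rewrite normrX lerXn2r ?nnegrE.
  apply: (le_trans (normrXB_le _ x1 y1)).
  by rewrite ler_wpM2l // mulr_ge0 // exprn_ge0.
rewrite normrM; case: j => [|j]; first by rewrite !expr0 subrr normr0 mulr0 !mul0r.
rewrite addnS /= exprD mulrCA -mulrA; apply: ler_pM => //.
  by rewrite normrX lerXn2r ?nnegrE.
apply: (le_trans (normrXB_le _ x2 y2)).
by rewrite ler_wpM2l // mulr_ge0 // exprn_ge0.
Qed.

Lemma sum_ord_single (N k : nat) (f : nat -> C) : (k < N)%N ->
  (forall i, i != k -> f i = 0) -> \sum_(i < N) f i = f k.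
Proof.
move=> kN f0; rewrite (bigD1 (Ordinal kN)) //= big1 ?addr0 // => i.
by rewrite -val_eqE; exact: f0.
Qed.

(** With [n <= 2 ^ (n - 1)], the factor [n] coming from differentiating a monomial
    of degree [n] is absorbed by halving the radius. *)
Lemma tail_le (r rho : C) n : 0 < r -> 0 <= rho -> 2 * rho <= r -> (1 < n)%N ->
  n%:R * rho ^+ n.-1 <= r ^+ n * (2 * rho / r ^+ 2).
Proof.
case: n => [|[|n]] // r0 rho0 rr _; rewrite /=.
have -> : r ^+ n.+2 * (2 * rho / r ^+ 2) = r ^+ n * (2 * rho).
  by rewrite -(addn2 n) exprD; field; rewrite gt_eqF.
have n2 : n.+2%:R <= 2 ^+ n.+1 :> C.
  by rewrite -natrX ler_nat; exact: ltn_expl.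
apply: (@le_trans _ _ (2 ^+ n.+1 * rho ^+ n.+1)).
  by rewrite ler_wpM2r // exprn_ge0.
rewrite -exprMn exprSr ler_wpM2r ?mulr_ge0 //.
by rewrite lerXn2r ?nnegrE ?mulr_ge0 // ltW.
Qed.

Lemma sum_ord_head2 (N : nat) (f : nat -> C) : (1 < N)%N ->
  (forall i, (1 < i)%N -> f i = 0) -> \sum_(i < N) f i = f 0%N + f 1%N.
Proof.
case: N => [|[|N]] // _ f0; rewrite !big_ord_recl big1 ?addr0 // => i _.
exact: f0.
Qed.

Lemma normr_sum2_le (N : nat) (T b : nat -> nat -> C) (kappa M : C) :
  0 <= kappa -> \sum_(i < N) \sum_(j < N) b i j <= M ->
  (forall i j, `|T i j| <= b i j * kappa) ->
  `|\sum_(i < N) \sum_(j < N) T i j| <= M * kappa.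
Proof.
move=> k0 bM Tb; apply: (@le_trans _ _ ((\sum_(i < N) \sum_(j < N) b i j) * kappa)).
  rewrite mulr_suml; apply: (le_trans (ler_norm_sum _ _ _)); apply: ler_sum => i _.
  rewrite mulr_suml; apply: (le_trans (ler_norm_sum _ _ _)); apply: ler_sum => j _.
  exact: Tb.
by rewrite ler_wpM2r.
Qed.

(** Strict differentiability at [a] with partial derivatives [c1] and [c2], in a
    quantitative form: the remainder is linear in the increment [eta] with a
    small factor [rho], the distance to [a]. Taking [z' = a] gives
    differentiability; taking [z] and [z'] both variable makes Newton's map a
    contraction. *)
Definition strict_diff A f a (c1 c2 : C) : Prop :=
  exists delta M : C, [/\ 0 < delta, 0 <= M &
    forall (rho eta : C) (z z' : C * C), A z -> A z' -> rho <= delta ->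
    `|z.1 - a.1| <= rho -> `|z.2 - a.2| <= rho ->
    `|z'.1 - a.1| <= rho -> `|z'.2 - a.2| <= rho ->
    `|z.1 - z'.1| <= eta -> `|z.2 - z'.2| <= eta ->
    `|f z - f z' - (c1 * (z.1 - z'.1) + c2 * (z.2 - z'.2))|
      <= M * (rho * eta)].

(** The remainder is the part of the series of total degree at least [2], and it
    is bounded term by term. *)
Lemma analytic2_strict_coef A f a : analytic2_on A f -> A a ->
  exists c1 c2 : C, strict_diff A f a c1 c2.
Proof.
move=> fA Aa; have [r [c [r0 [M sumM] fE]]] := fA a Aa.
have M0 : 0 <= M by have := sumM 0%N; rewrite big_ord0.
have r40 : 0 < r / 4 by rewrite divr_gt0.
(* [r / 4] leaves room both for [rho < r] and for [2 * rho <= r]. *)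
exists (c 1%N 0%N), (c 0%N 1%N), (r / 4), (M * (2 / r ^+ 2)); split => //.
  by rewrite mulr_ge0 // divr_ge0 // exprn_ge0 // ltW.
move=> rho eta z z' Az Az' rr z1 z2 z1' z2' e1 e2.
have rho0 := le_trans (normr_ge0 _) z1.
have eta0 := le_trans (normr_ge0 _) e1.
have rr4 : r / 4 < r by rewrite ltr_pdivrMr // ltr_pMr // ltr1n.
have lt_r (w : C) (wr : `|w| <= rho) : `|w| < r.
  exact: le_lt_trans wr (le_lt_trans rr rr4).
set S := fun (N : nat) (w : C * C) => \sum_(i < N) \sum_(j < N)
             c i j * (w.1 - a.1) ^+ i * (w.2 - a.2) ^+ j.
have Sz : (S ^~ z) @ \oo --> f z by exact: fE z Az (lt_r _ z1) (lt_r _ z2).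
have Sz' : (S ^~ z') @ \oo --> f z' by exact: fE z' Az' (lt_r _ z1') (lt_r _ z2').
set L := _ * (_ - _) + _.
apply: (norm_lim_le (G := \oo) (u := fun N => S N z - S N z' - L)
  (b := cst (M * (2 / r ^+ 2) * (rho * eta)))).
- by apply: cvgB; [exact: cvgB | exact: cvg_cst].
- exact: cvg_cst.
near=> N; have N1 : (1 < N)%N by near: N; exact: nbhs_infty_gt.
pose x := (z.1 - a.1, z.2 - a.2); pose y := (z'.1 - a.1, z'.2 - a.2).
have xy1 : z.1 - z'.1 = x.1 - y.1 by rewrite /=; ring.
have xy2 : z.2 - z'.2 = x.2 - y.2 by rewrite /=; ring.
(* [W] is the general term of the difference, split into its part [V] of degree
   at most 1 and its tail [T]. *)
pose W i j := c i j * (x.1 ^+ i * x.2 ^+ j - y.1 ^+ i * y.2 ^+ j).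
pose V i j := if (1 < i + j)%N then 0 else W i j.
pose T i j := if (1 < i + j)%N then W i j else 0.
have SS : S N z - S N z' = \sum_(i < N) \sum_(j < N) W i j.
  rewrite /S -sumrB; apply: eq_bigr => i _; rewrite -sumrB; apply: eq_bigr => j _.
  by rewrite /W mulrBr !mulrA.
have LV : L = \sum_(i < N) \sum_(j < N) V i j.
  rewrite (@sum_ord_head2 N (fun i => \sum_(j < N) V i j)) //; last first.
    move=> i i1; rewrite big1 // => j _.
    by rewrite /V (leq_trans i1) ?leq_addr.
  rewrite !sum_ord_head2 //; last 2 first.
  - by move=> [|[|j]].
  - by move=> [|[|j]].
  by rewrite /L xy1 xy2 /V /W /= !expr0 !expr1; ring.
have -> : S N z - S N z' - L = \sum_(i < N) \sum_(j < N) T i j.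
  rewrite SS LV -sumrB; apply: eq_bigr => i _; rewrite -sumrB.
  by apply: eq_bigr => j _; rewrite /V /T; case: ifP; rewrite ?subr0 ?subrr.
have kappa0 : 0 <= 2 / r ^+ 2 * (rho * eta).
  by rewrite !mulr_ge0 // invr_ge0 exprn_ge0 // ltW.
rewrite /cst -[M * _ * _]mulrA.
apply: (normr_sum2_le (b := fun i j => `|c i j| * r ^+ (i + j)) (T := T)
  kappa0 (sumM N)).
move=> i j; rewrite /T; case: ifPn => [ij|_]; last first.
  by rewrite normr0 !mulr_ge0 ?exprn_ge0 ?invr_ge0 ?exprn_ge0 // ltW.
rewrite /W normrM -[leRHS]mulrA ler_wpM2l //.
rewrite xy1 in e1; rewrite xy2 in e2.
apply: (le_trans (@monomialB_le x y rho eta i j z1 z2 z1' z2' e1 e2)).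
have -> : r ^+ (i + j) * (2 / r ^+ 2 * (rho * eta)) =
  r ^+ (i + j) * (2 * rho / r ^+ 2) * eta by ring.
rewrite ler_wpM2r // tail_le //.
apply: (@le_trans _ _ (2 * (r / 4))); first by rewrite ler_wpM2l.
by rewrite mulrCA ler_piMr ?(ltW r0) // ler_pdivrMr // mul1r ler_nat.
Unshelve. all: by end_near. Qed.

(** At the centre [(e, q)] the powers of the first variable are powers of [0], so
    the slice has the coefficients [c 0 j k]. *)
Lemma analytic3_slice D (g : C * (C * C) -> C) e :
  analytic3_on D g -> analytic2_on (domain_at D e) (fun q => g (e, q)).
Proof.
move=> gD q Dq; have [r [c [r0 [M sumM] gE]]] := gD _ Dq.
exists r, (c 0%N); split => //.
  exists M => N; apply: le_trans (sumM N); case: N => [|N].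
    by rewrite !big_ord0.
  rewrite [leRHS]big_ord_recl lerDl; apply: sumr_ge0 => i _.
  apply: sumr_ge0 => j _; apply: sumr_ge0 => k _.
  by rewrite mulr_ge0 // exprn_ge0 // ltW.
move=> z Dz z1 z2.
have := gE (e, z) Dz; rewrite /= subrr normr0 => /(_ r0 z1 z2).
apply: cvg_trans; apply: near_eq_cvg; near=> N.
have N0 : (0 < N)%N by near: N; exact: nbhs_infty_gt.
rewrite (@sum_ord_single N 0%N (fun i => \sum_(j < N) \sum_(k < N)
             c i j k * 0 ^+ i * (z.1 - q.1) ^+ j * (z.2 - q.2) ^+ k)) //.
  by apply: eq_bigr => j _; apply: eq_bigr => k _; rewrite expr0 mulr1.
move=> i i0; rewrite big1 // => j _; rewrite big1 // => k _.
by rewrite expr0n (negbTE i0) mulr0 !mul0r.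
Unshelve. all: by end_near. Qed.

(** Since [i + m > 2] with both positive, one of the two factors carries an extra
    power: this is where [E + eta] comes from. *)
Lemma mixed_tail_le (r E eta : C) (i m : nat) :
  0 < r -> 0 <= E <= r -> 0 <= eta <= r -> (0 < i)%N -> (0 < m)%N ->
  (2 < i + m)%N ->
  E ^+ i * eta ^+ m <= r ^+ (i + m) * (E * eta * (E + eta) / r ^+ 3).
Proof.
move=> r0 /andP[E0 Er] /andP[e0 er]; case: i m => [|i] [|m] // _ _.
have rn : r != 0 by rewrite gt_eqF.
have pw (x : C) n : 0 <= x <= r -> x ^+ n <= r ^+ n.
  by move=> /andP[x0 xr]; rewrite lerXn2r ?nnegrE // ltW.
suff H : (0 < i + m)%N -> E ^+ i * eta ^+ m <= r ^+ (i + m).-1 * (E + eta).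
  rewrite addSn addnS !ltnS => im.
  have -> : r ^+ (i + m).+2 * (E * eta * (E + eta) / r ^+ 3) =
     (E * eta) * (r ^+ (i + m).-1 * (E + eta)).
    by rewrite -{1}(prednK im) !exprS expr0; field.
  have -> : E ^+ i.+1 * eta ^+ m.+1 = (E * eta) * (E ^+ i * eta ^+ m).
    by rewrite !exprS; ring.
  by rewrite ler_wpM2l ?mulr_ge0 //; exact: H.
case: i => [|i].
  case: m => [//|m] _; rewrite add0n /= mul1r exprSr.
  by apply: ler_pM; rewrite ?exprn_ge0 ?lerDr // pw // e0.
move=> _; rewrite addSn /= exprSr mulrAC.
apply: ler_pM; rewrite ?mulr_ge0 ?exprn_ge0 ?lerDl // exprD.
by apply: ler_pM; rewrite ?exprn_ge0 ?pw ?E0 ?e0.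
Qed.

(** In the second difference the terms free of [e] and those free of [z] cancel;
    of the remaining ones only [e * (z.1 - q.1)] and [e * (z.2 - q.2)] have degree 2.
    The bound still tends to [0] after division by both [`|e|] and [eta]. *)
Lemma analytic3_mixed_coef D (g : C * (C * C) -> C) (q : C * C) :
  analytic3_on D g -> D (0, q) ->
  exists c1 c2 delta M : C, [/\ 0 < delta, 0 <= M &
    forall (e eta : C) (z : C * C), D (e, z) -> D (e, q) -> D (0, z) ->
    `|e| < delta -> eta < delta ->
    `|z.1 - q.1| <= eta -> `|z.2 - q.2| <= eta ->
    `|g (e, z) - g (e, q) - (g (0, z) - g (0, q))
       - e * (c1 * (z.1 - q.1) + c2 * (z.2 - q.2))|
      <= M * (`|e| * eta * (`|e| + eta))].
Proof.
move=> gD Dq; have [r [c [r0 [M sumM] gE]]] := gD _ Dq.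
have M0 : 0 <= M by have := sumM 0%N; rewrite big_ord0.
exists (c 1 1 0)%N, (c 1 0 1)%N, r, (M / r ^+ 3); split => //.
  by rewrite mulr_ge0 // invr_ge0 exprn_ge0 // ltW.
move=> e eta z Dez Deq D0z er etar z1 z2.
have eta0 := le_trans (normr_ge0 _) z1.
set S := fun (N : nat) (w : C * (C * C)) =>
  \sum_(i < N) \sum_(j < N) \sum_(k < N) c i j k * (w.1 - 0) ^+ i
     * (w.2.1 - q.1) ^+ j * (w.2.2 - q.2) ^+ k.
have Slim w : D w -> `|w.1| < r -> `|w.2.1 - q.1| <= eta ->
    `|w.2.2 - q.2| <= eta -> (S ^~ w) @ \oo --> g w.
  move=> Dw w0 w1 w2; apply: gE => //=; first by rewrite subr0.
    exact: le_lt_trans etar.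
  exact: le_lt_trans etar.
have S1 := Slim (e, z) Dez er z1 z2.
have S2 : (S ^~ (e, q)) @ \oo --> g (e, q).
  by apply: Slim; rewrite //= subrr normr0.
have S3 : (S ^~ (0, z)) @ \oo --> g (0, z).
  by apply: Slim; rewrite //= normr0.
have S4 : (S ^~ (0, q)) @ \oo --> g (0, q).
  by apply: Slim; rewrite //= ?subrr normr0.
set L := e * _.
apply: (norm_lim_le (G := \oo)
  (u := fun N => S N (e, z) - S N (e, q) - (S N (0, z) - S N (0, q)) - L)
  (b := cst (M / r ^+ 3 * (`|e| * eta * (`|e| + eta))))).
- by apply: cvgB; [do !apply: cvgB | exact: cvg_cst].
- exact: cvg_cst.
near=> N; have N1 : (1 < N)%N by near: N; exact: nbhs_infty_gt.
pose x := z.1 - q.1; pose y := z.2 - q.2.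
pose W i j k := c i j k * ((e ^+ i - 0 ^+ i) * (x ^+ j * y ^+ k - 0 ^+ (j + k))).
(* The terms in [e * (z.1 - q.1)] and [e * (z.2 - q.2)]. *)
pose low i j k := (i == 1)%N && (j + k == 1)%N.
pose V i j k := if low i j k then W i j k else 0.
pose T i j k := if low i j k then 0 else W i j k.
have SS : S N (e, z) - S N (e, q) - (S N (0, z) - S N (0, q)) =
    \sum_(i < N) \sum_(j < N) \sum_(k < N) W i j k.
  rewrite /S -!sumrB; apply: eq_bigr => i _; rewrite -!sumrB.
  apply: eq_bigr => j _; rewrite -!sumrB; apply: eq_bigr => k _.
  by rewrite /W /= !subr0 !subrr exprD -/x -/y; ring.
have LV : L = \sum_(i < N) \sum_(j < N) \sum_(k < N) V i j k.
  rewrite (@sum_ord_single N 1 (fun i => \sum_(j < N) \sum_(k < N) V i j k)) //;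
    last first.
    move=> i i1; rewrite big1 // => j _; rewrite big1 // => k _.
    by rewrite /V /low (negbTE i1).
  rewrite (@sum_ord_head2 N (fun j => \sum_(k < N) V 1%N j k)) //; last first.
    move=> [|[|j]] // _; rewrite big1 // => k _.
  rewrite !sum_ord_head2 //; last 2 first.
  - by move=> [|[|k]].
  - by move=> [|[|k]].
  by rewrite /L /V /W /low /= -/x -/y !addn0 !add0n !expr0 !expr1; ring.
have -> : S N (e, z) - S N (e, q) - (S N (0, z) - S N (0, q)) - L =
    \sum_(i < N) \sum_(j < N) \sum_(k < N) T i j k.
  rewrite SS LV -sumrB; apply: eq_bigr => i _; rewrite -sumrB.
  apply: eq_bigr => j _; rewrite -sumrB; apply: eq_bigr => k _.
  by rewrite /V /T; case: ifP; rewrite ?subr0 ?subrr.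
have kappa0 : 0 <= `|e| * eta * (`|e| + eta) / r ^+ 3.
  by rewrite !mulr_ge0 ?addr_ge0 // invr_ge0 exprn_ge0 // ltW.
rewrite /cst -mulrA [_^-1 * _]mulrC.
apply: (le_trans (ler_norm_sum _ _ _)).
apply: (le_trans _ (ler_wpM2r kappa0 (sumM N))).
rewrite mulr_suml; apply: ler_sum => i _.
apply: (normr_sum2_le (b := fun j k => `|c i j k| * r ^+ (i + j + k))
  (T := T i) kappa0 (lexx _)) => j k.
have rhs0 : 0 <= `|c i j k| * r ^+ (i + j + k) *
    (`|e| * eta * (`|e| + eta) / r ^+ 3).
  by rewrite mulr_ge0 // mulr_ge0 // exprn_ge0 // ltW.
rewrite /T; case: ifPn => [_|lowN]; first by rewrite normr0.
have [i0|i0] := posnP i.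
  by have -> : W i j k = 0; rewrite ?normr0 // /W i0 !expr0 subrr mul0r mulr0.
have [/eqP jk0|jk0] := posnP (j + k).
  have -> : W i j k = 0; last by rewrite normr0.
  move: jk0; rewrite addn_eq0 /W => /andP[/eqP -> /eqP ->].
  by rewrite !expr0 mulr1 subrr !mulr0.
rewrite /W !expr0n (gtn_eqF i0) (gtn_eqF jk0) /= !subr0 !normrM !normrX.
rewrite -[leRHS]mulrA ler_wpM2l //.
rewrite -addnA; apply: le_trans (mixed_tail_le r0 _ _ i0 jk0 _).
- by rewrite ler_wpM2l ?exprn_ge0 // exprD ler_pM ?exprn_ge0 // lerXn2r ?nnegrE.
- by rewrite normr_ge0 ltW.
- by rewrite eta0 ltW.
- move: lowN i0 jk0; rewrite /low.
  by case: (nat_of_ord i) (j + k)%N => [|[|i']] [|[|m]] //=; rewrite !addSn ?addnS.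
Unshelve. all: by end_near. Qed.

(** * Derivatives of sums of power series *)

Lemma cvg0_le {T : Type} {G : set_system T} {FG : Filter G} (u b : T -> C) :
  b @ G --> (0 : C) -> (\forall t \near G, `|u t| <= b t) -> u @ G --> (0 : C).
Proof.
move=> b0 ub; apply/cvgr0Pnorm_lt => e e0.
have /cvgr0Pnorm_lt /(_ e e0) := b0; apply: filterS2 ub => t ut.
by rewrite (ger0_norm (le_trans (normr_ge0 _) ut)); exact: le_lt_trans.
Qed.

Lemma cvg_fst_comp {T : Type} {G : set_system T} {FG : Filter G} (u : T -> C * C) v :
  u @ G --> v -> (fun t => (u t).1) @ G --> v.1.
Proof. by move=> uv; apply: (cvg_comp u fst uv); exact: cvg_fst. Qed.

Lemma cvg_snd_comp {T : Type} {G : set_system T} {FG : Filter G} (u : T -> C * C) v :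
  u @ G --> v -> (fun t => (u t).2) @ G --> v.2.
Proof. by move=> uv; apply: (cvg_comp u snd uv); exact: cvg_snd. Qed.

(** Quotients are taken along any filter [G] finer than the punctured
    neighbourhoods of [0], so as to cover both complex and real parameters. *)
Section along.
Context {G : set_system C} {FG : Filter G} (G0 : G `=>` (0 : C)^').

Lemma near_neq0 : \forall t \near G, t != 0.
Proof. exact: (G0 (nbhs_dnbhs_neq (0 : C))). Qed.

Lemma along_cvg0 : id @ G --> (0 : C).
Proof. by move=> B B0; apply: G0; exact: cvg_within B0. Qed.

Lemma quotient_cvg {u : C -> C} {l w : C} :
  (fun t => t^-1 * (u t - l)) @ G --> w -> u @ G --> l.
Proof.
move=> uw; rewrite -[l]add0r -[0](mul0r w).
apply: (@cvg_trans _ ((fun t => t * (t^-1 * (u t - l)) + l) @ G)).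
  apply: near_eq_cvg; apply: filterS near_neq0 => t t0.
  by rewrite /= mulrA divff // mul1r subrK.
by apply: cvgD; [apply: cvgM => //; exact: along_cvg0 | exact: cvg_cst].
Qed.

(** The chain rule for a curve of which only the difference quotient at [a] is
    known to converge. *)
Lemma strict_chain A f a c1 c2 (gamma : C -> C * C) v :
  open A -> A a -> strict_diff A f a c1 c2 ->
  (fun t => t^-1 *: (gamma t - a)) @ G --> v ->
  (fun t => t^-1 * (f (gamma t) - f a)) @ G --> c1 * v.1 + c2 * v.2.
Proof.
move=> oA Aa [delta [M [d0 M0 fS]]] gv.
have g1 : (fun t => t^-1 * ((gamma t).1 - a.1)) @ G --> v.1.
  exact: cvg_fst_comp gv.
have g2 : (fun t => t^-1 * ((gamma t).2 - a.2)) @ G --> v.2.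
  exact: cvg_snd_comp gv.
have l1 := [elaborate quotient_cvg g1]; have l2 := [elaborate quotient_cvg g2].
have la : gamma @ G --> a.
  have -> : gamma = (fun t => ((gamma t).1, (gamma t).2)).
    by apply/funext => t; rewrite -surjective_pairing.
  by rewrite [a]surjective_pairing; exact: (cvg_pair l1 l2).
pose k1 t := (gamma t).1 - a.1; pose k2 t := (gamma t).2 - a.2.
pose n t := `|k1 t| + `|k2 t|.
have n0 : n @ G --> 0.
  rewrite -[0]addr0 -(@normr0 _ C) -{1}(subrr a.1) -(subrr a.2).
  by apply: cvgD; apply: cvg_norm; apply: cvgB => //; exact: cvg_cst.
pose lin t := c1 * (t^-1 * k1 t) + c2 * (t^-1 * k2 t).
have lin_v : lin @ G --> c1 * v.1 + c2 * v.2.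
  by apply: cvgD; (apply: cvgM; [exact: cvg_cst|]).
suff rem0 : (fun t => t^-1 * (f (gamma t) - f a) - lin t) @ G --> 0.
  rewrite -[_ + _]add0r.
  apply: cvg_trans (cvgD rem0 lin_v); apply: near_eq_cvg; apply: nearW => t.
  by rewrite /= subrK.
pose b t := M * n t * (`|t^-1 * k1 t| + `|t^-1 * k2 t|).
apply: (cvg0_le (b := b)).
  rewrite -[0](mul0r (`|v.1| + `|v.2|)) -(mulr0 M).
  apply: cvgM; first by apply: cvgM => //; exact: cvg_cst.
  by apply: cvgD; exact: cvg_norm.
have /cvgr0Pnorm_lt /(_ delta d0) n_lt := n0.
near=> t.
have At : A (gamma t) by near: t; apply: la; exact: open_nbhs_nbhs.
have nd : n t <= delta.
  have : `|n t| < delta by near: t; exact: n_lt.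
  by rewrite ger0_norm ?addr_ge0 // => /ltW.
have kn1 : `|k1 t| <= n t by rewrite lerDl.
have kn2 : `|k2 t| <= n t by rewrite lerDr.
have := fS _ _ _ _ At Aa nd kn1 kn2.
rewrite !subrr normr0 => /(_ _ (addr_ge0 _ _) (addr_ge0 _ _) kn1 kn2).
move=> /(_ (normr_ge0 _) (normr_ge0 _) (normr_ge0 _) (normr_ge0 _)) fb.
have -> : t^-1 * (f (gamma t) - f a) - lin t =
  t^-1 * (f (gamma t) - f a - (c1 * k1 t + c2 * k2 t)) by rewrite /lin; ring.
rewrite normrM /b !normrM -mulrDr mulrCA -mulrA ler_wpM2l //.
Unshelve. all: by end_near. Qed.
End along.

Lemma line_quotient_cvg (a v : C * C) :
  (fun t : C => t^-1 *: (t *: v + a - a)) @ (0 : C)^' --> v.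
Proof.
apply: (@cvg_trans _ (cst v @ (0 : C)^')); last exact: cvg_cst.
apply: near_eq_cvg; apply: filterS (nbhs_dnbhs_neq (0 : C)) => t t0.
by rewrite /= addrK scalerA mulVf // scale1r.
Qed.

Lemma strict_derive A f a c1 c2 v : open A -> A a -> strict_diff A f a c1 c2 ->
  'D_v f a = c1 * v.1 + c2 * v.2.
Proof.
move=> oA Aa fS; apply: cvg_lim; first exact: norm_hausdorff.
exact: (@strict_chain (0 : C)^' _ (fun _ H => H) A f a c1 c2
  (fun t => t *: v + a) v oA Aa fS (@line_quotient_cvg a v)).
Qed.

Lemma analytic2_strict A f a : open A -> analytic2_on A f -> A a ->
  strict_diff A f a (d_x f a) (d_y f a).
Proof.
move=> oA fA Aa; have [c1 [c2 fS]] := analytic2_strict_coef fA Aa.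
rewrite /d_x /d_y !(strict_derive _ oA Aa fS) /=.
by rewrite !mulr0 !mulr1 addr0 add0r.
Qed.

Lemma cvg0Ml {T : Type} {G : set_system T} {FG : Filter G} (k : C) (u : T -> C) :
  u @ G --> (0 : C) -> (fun t => k * u t) @ G --> (0 : C).
Proof.
by move=> u0; rewrite -[X in _ --> X](mulr0 k); exact: cvgM (cvg_cst k) u0.
Qed.

Lemma cvg0_norm {T : Type} {G : set_system T} {FG : Filter G} (u : T -> C) :
  u @ G --> (0 : C) -> (fun t => `|u t|) @ G --> (0 : C).
Proof.
by move=> u0; rewrite -[X in _ --> X](@normr0 _ C); exact: cvg_norm.
Qed.

Lemma analytic2_chain {G : set_system C} {FG : Filter G} (G0 : G `=>` (0 : C)^')
    A f a (gamma : C -> C * C) v :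
  open A -> analytic2_on A f -> A a ->
  (fun t => t^-1 *: (gamma t - a)) @ G --> v ->
  (fun t => t^-1 * (f (gamma t) - f a)) @ G --> d_x f a * v.1 + d_y f a * v.2.
Proof.
by move=> oA fA Aa; apply: (strict_chain G0 oA Aa); exact: analytic2_strict oA fA Aa.
Qed.

Lemma analytic2_derive A f a v : open A -> analytic2_on A f -> A a ->
  'D_v f a = d_x f a * v.1 + d_y f a * v.2.
Proof.
by move=> oA fA Aa; exact: strict_derive oA Aa (analytic2_strict oA fA Aa).
Qed.

Lemma analytic2_derive_cvg A f a v : open A -> analytic2_on A f -> A a ->
  (fun t => t^-1 * (f (t *: v + a) - f a)) @ (0 : C)^' --> 'D_v f a.
Proof.
move=> oA fA Aa; rewrite (analytic2_derive v oA fA Aa).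
apply: (@analytic2_chain (0 : C)^' _ (fun _ H => H) A f a
  (fun t => t *: v + a) v) => //.
exact: line_quotient_cvg.
Qed.

Lemma line_cvg (a v : C * C) : (fun t : C => t *: v + a) @ (0 : C)^' --> a.
Proof.
rewrite -[X in _ --> X]add0r -(scale0r v); apply: cvgD; last exact: cvg_cst.
apply: cvgZ; last exact: cvg_cst.
by move=> B B0; exact: cvg_within B0.
Qed.

Section mixed.
Context {G : set_system C} {FG : ProperFilter G} (G0 : G `=>` (0 : C)^').
Variables (D : set (C * (C * C))) (g : C * (C * C) -> C) (alpha : C * C -> C).
Hypothesis Dopen : forall e, open (domain_at D e).
Hypothesis Dnear : forall z, D (0, z) -> \forall e \near G, D (e, z).
Hypothesis gD : analytic3_on D g.
Hypothesis galpha : forall z, D (0, z) ->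
  (fun e => e^-1 * (g (e, z) - g (0, z))) @ G --> alpha z.

(** Dividing the mixed second difference by [e] first, then by the space
    increment, shows that [c1] and [c2] are the partial derivatives of [alpha];
    dividing in the other order gives the left-hand side the same limit. *)
Lemma mixed_derivative q v : D (0, q) ->
  (fun e => e^-1 * ('D_v (fun z => g (e, z)) q - 'D_v (fun z => g (0, z)) q))
    @ G --> 'D_v alpha q.
Proof.
move=> Dq; have [c1 [c2 [delta [M [d0 M0 gM]]]]] := analytic3_mixed_coef gD Dq.
pose w := `|v.1| + `|v.2|; pose cv := c1 * v.1 + c2 * v.2.
have w0 : 0 <= w by rewrite addr_ge0.
have gline e (t : C) : D (e, t *: v + q) -> D (e, q) -> D (0, t *: v + q) ->
    `|e| < delta -> `|t| * w < delta ->
    `|g (e, t *: v + q) - g (e, q) - (g (0, t *: v + q) - g (0, q)) - e * (t * cv)|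
      <= M * (`|e| * (`|t| * w) * (`|e| + `|t| * w)).
  move=> D1 D2 D3 ed td.
  have -> : t * cv = c1 * ((t *: v + q).1 - q.1) + c2 * ((t *: v + q).2 - q.2).
    by rewrite /cv /= /GRing.scale /=; ring.
  apply: gM => //.
    by rewrite /= addrK /GRing.scale /= normrM ler_wpM2l // lerDl.
  by rewrite /= addrK /GRing.scale /= normrM ler_wpM2l // lerDr.
have near_e : \forall e \near G, [/\ e != 0, `|e| < delta & D (e, q)].
  have e_lt : \forall e \near G, `|e| < delta.
    by have /cvgr0Pnorm_lt := along_cvg0 G0; exact.
  by apply: filterS3 (near_neq0 G0) e_lt (Dnear Dq).
have t0 : (fun t : C => t) @ (0 : C)^' --> (0 : C).
  by move=> B B0; exact: cvg_within B0.
have tw0 : (fun t : C => `|t| * w) @ (0 : C)^' --> (0 : C).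
  suff : (fun t : C => `|t| * w) @ (0 : C)^' --> `|0 : C| * w.
    by rewrite normr0 mul0r.
  by apply: cvgM; [exact: cvg_norm | exact: cvg_cst].
have near_t e : D (e, q) -> \forall t \near (0 : C)^',
    [/\ t != 0, `|t| * w < delta & D (e, t *: v + q)].
  move=> De; have /cvgr0Pnorm_lt /(_ delta d0) t_lt := tw0.
  have Dt : \forall t \near (0 : C)^', D (e, t *: v + q).
    by apply: (@line_cvg q v (domain_at D e)); apply: open_nbhs_nbhs.
  apply: filterS3 (nbhs_dnbhs_neq (0 : C)) t_lt Dt => t tn; rewrite ger0_norm //.
  by rewrite mulr_ge0.
have Dalpha : 'D_v alpha q = cv.
  apply: cvg_lim; first exact: norm_hausdorff.
  rewrite -[cv]add0r.
  suff : (fun t => t^-1 * (alpha (t *: v + q) - alpha q) - cv) @ (0 : C)^'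
      --> (0 : C).
    move=> H; have := [elaborate cvgD H (cvg_cst cv)]; apply: cvg_trans.
    by apply: near_eq_cvg; apply: nearW => t; rewrite /= subrK.
  apply: (cvg0_le (b := fun t => M * w * (`|t| * w))).
    exact: cvg0Ml.
  apply: filterS (near_t 0 Dq) => t [tn td Dt].
  have -> : t^-1 * (alpha (t *: v + q) - alpha q) - cv =
      t^-1 * (alpha (t *: v + q) - alpha q - t * cv) by field.
  rewrite normrM normfV ler_pdivrMl ?normr_gt0 //.
  have -> : `|t| * (M * w * (`|t| * w)) = M * (`|t| * w * (0 + `|t| * w)) by ring.
  apply: (@norm_lim_le _ G _
     (fun e => e^-1 * (g (e, t *: v + q) - g (0, t *: v + q)) -
        e^-1 * (g (e, q) - g (0, q)) - t * cv)
     (fun e => M * (`|t| * w * (`|e| + `|t| * w)))).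
  - apply: cvgB; last exact: cvg_cst.
    by apply: cvgB; exact: galpha.
  - apply: cvgM; first exact: cvg_cst.
    apply: cvgM; first exact: cvg_cst.
    apply: cvgD; last exact: cvg_cst.
    by apply: cvg0_norm; exact: along_cvg0 G0.
  apply: filterS2 near_e (Dnear Dt) => e [en ed De] Det.
  have := gline e t Det De Dt ed td.
  have -> : e^-1 * (g (e, t *: v + q) - g (0, t *: v + q))
     - e^-1 * (g (e, q) - g (0, q)) - t * cv = e^-1 * (
    g (e, t *: v + q) - g (e, q) - (g (0, t *: v + q) - g (0, q)) - e * (t * cv)).
    by field.
  rewrite normrM normfV ler_pdivrMl ?normr_gt0 // => /le_trans; apply.
  by rewrite -mulrA mulrCA.
have slice e : D (e, q) ->
    (fun t => t^-1 * (g (e, t *: v + q) - g (e, q))) @ (0 : C)^' -->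
      'D_v (fun z => g (e, z)) q.
  move=> De.
  exact: (analytic2_derive_cvg (v := v) (@Dopen e) (analytic3_slice (e := e) gD) De).
rewrite Dalpha -[X in _ --> X]add0r.
suff : (fun e => e^-1 * ('D_v (fun z => g (e, z)) q - 'D_v (fun z => g (0, z)) q)
    - cv) @ G --> (0 : C).
  move=> H; have := [elaborate cvgD H (cvg_cst cv)]; apply: cvg_trans.
  by apply: near_eq_cvg; apply: nearW => t; rewrite /= subrK.
apply: (cvg0_le (b := fun e => M * w * `|e|)).
  by apply: cvg0Ml; apply: cvg0_norm; exact: along_cvg0 G0.
apply: filterS near_e => e [en ed De].
set d1 := 'D_v _ _; set d2 := 'D_v _ _.
have -> : e^-1 * (d1 - d2) - cv = e^-1 * (d1 - d2 - e * cv) by field.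
rewrite normrM normfV ler_pdivrMl ?normr_gt0 //.
have -> : `|e| * (M * w * `|e|) = M * (`|e| * w * (`|e| + 0)) by ring.
apply: (@norm_lim_le _ (0 : C)^' _
  (fun t => t^-1 * (g (e, t *: v + q) - g (e, q))
     - t^-1 * (g (0, t *: v + q) - g (0, q)) - e * cv)
  (fun t => M * (`|e| * w * (`|e| + `|t| * w)))).
- apply: cvgB; last exact: cvg_cst.
  by apply: cvgB; exact: slice.
- apply: cvgM; first exact: cvg_cst.
  apply: cvgM; first exact: cvg_cst.
  by apply: cvgD => //; exact: cvg_cst.
apply: filterS2 (near_t e De) (near_t 0 Dq) => t [tn td Det] [_ _ Dt].
have := gline e t Det De Dt ed td.
have -> : t^-1 * (g (e, t *: v + q) - g (e, q))
     - t^-1 * (g (0, t *: v + q) - g (0, q)) - e * cv = t^-1 * (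
    g (e, t *: v + q) - g (e, q) - (g (0, t *: v + q) - g (0, q)) - e * (t * cv)).
  by field.
rewrite normrM normfV ler_pdivrMl ?normr_gt0 // => /le_trans; apply.
by rewrite le_eqVlt; apply/orP; left; apply/eqP; ring.
Qed.
End mixed.
End PowerSeries.

(** * Completeness of the complex numbers and level sets *)

(** The only form of completeness that Newton's iteration uses. *)
Definition geometric_complete (C : numClosedFieldType) : Prop :=
  forall (y : nat -> C) (b : C),
    (forall n, `|y n.+1 - y n| <= b * 2^-1 ^+ n) ->
    exists l : C, y @ \oo --> l.

Lemma geometric_step_cvg_real (R : realType) (u : nat -> R) (b : R) :
  (forall n, `|u n.+1 - u n| <= b * 2^-1 ^+ n) -> exists l : R, u @ \oo --> l.
Proof.
move=> ub; have b0 : 0 <= b.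
  by have := le_trans (normr_ge0 _) (ub 0%N); rewrite mulr1.
have tc : cvgn (series (telescope u)).
  apply: (normed_cvg (V := R^o)).
  apply: (@series_le_cvg R (fun n => `|telescope u n|) (geometric b 2^-1)) => //.
  - by move=> n; rewrite /geometric mulr_ge0 // exprn_ge0.
  - apply: is_cvg_geometric_series.
    by rewrite ger0_norm ?invr_ge0 // invf_lt1 // ltr1n.
exists (limn (series (telescope u)) + u 0%N).
have := [elaborate cvgD tc (cvg_cst (u 0%N))]; apply: cvg_trans.
apply: near_eq_cvg; apply: nearW => n.
by rewrite /= telescopeK subrK.
Qed.

Section complete.
Variable R : realType.
Local Notation C := (Cplx R).
Local Notation inC := (fun x : R => (real_complex R x : C)).

Lemma real_complex_cvg (u : nat -> R) (l : R) :
  u @ \oo --> l -> (fun n => inC (u n)) @ \oo --> inC l.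
Proof.
move=> /cvgrPdist_lt ul; apply/cvgrPdist_lt => e e0.
have eE : e = inC (complex.Re e) by rewrite RRe_real // gtr0_real.
have e0' : 0 < complex.Re e by rewrite -ltcR -/(inC _) -eE.
apply: filterS (ul _ e0') => n; rewrite eE -rmorphB normc_def /=.
by rewrite expr0n addr0 sqrtr_sqr ltcR.
Qed.

Lemma Cplx_geometric_complete : geometric_complete C.
Proof.
move=> y b yb; have b0 : 0 <= b.
  by have := le_trans (normr_ge0 _) (yb 0%N); rewrite mulr1.
have bE : b = inC (complex.Re b) by rewrite RRe_real // ger0_real.
have half n : b * 2^-1 ^+ n = inC (complex.Re b * 2^-1 ^+ n).
  by rewrite bE rmorphM rmorphXn fmorphV rmorph_nat.
have [lr lrP] : exists l : R, (fun n => complex.Re (y n)) @ \oo --> l.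
  apply: (@geometric_step_cvg_real _ _ (complex.Re b)) => n.
  have := le_trans (normc_ge_Re _) (yb n).
  by rewrite half lecR raddfB.
have [li liP] : exists l : R, (fun n => complex.Im (y n)) @ \oo --> l.
  apply: (@geometric_step_cvg_real _ _ (complex.Re b)) => n.
  have : `|(y n.+1 - y n) * 'i%C| <= b * 2^-1 ^+ n.
    rewrite normrM (_ : `|'i%C| = 1) ?mulr1 // normc_def /=.
    by rewrite expr0n expr1n add0r sqrtr1.
  move=> /(le_trans (normc_ge_Re _)).
  by rewrite ReiNIm half lecR normrN raddfB.
exists (inC lr + 'i%C * inC li).
have := [elaborate cvgD (real_complex_cvg lrP)
  (cvgM (cvg_cst ('i%C : C)) (real_complex_cvg liP))].
apply: cvg_trans; apply: near_eq_cvg; apply: nearW => n.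
by rewrite /= [RHS]complexE.
Qed.
End complete.

Lemma exists_pos_le2 (C : numDomainType) (x y : C) : 0 < x -> 0 < y ->
  exists z, [/\ 0 < z, z <= x & z <= y].
Proof.
move=> x0 y0; have [xy|yx] := real_leP (gtr0_real x0) (gtr0_real y0).
  by exists x.
by exists y; split => //; exact: ltW.
Qed.

Lemma open_box (C : numClosedFieldType) (A : set (C * C)) (a : C * C) :
  open A -> A a -> exists2 r : C, 0 < r &
  forall z, `|z.1 - a.1| < r -> `|z.2 - a.2| < r -> A z.
Proof.
move=> oA Aa; have /nbhs_ballP[r /= r0 rA] : nbhs a A by exact: open_nbhs_nbhs.
exists r => // z z1 z2; apply: rA.
by split; rewrite -ball_normE /= distrC.
Qed.

(** For [xi] small and nonzero, the equation [f (a.1 + xi, a.2 + y) = f a] is solved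
    for [y] by the simplified Newton iteration [y - phi y / b] with [b = d_y f a];
    strict differentiability makes it a contraction of ratio 1/2 of the ball of
    radius [rho]. The solution has first coordinate [a.1 + xi], hence differs
    from [a]. *)
Lemma level_set_not_isolated (C : numClosedFieldType) (A : set (C * C))
    (f : C * C -> C) (a : C * C) : geometric_complete C ->
  open A -> analytic2_on A f -> A a -> d_y f a != 0 ->
  exists z, [/\ A z, z != a & f z = f a].
Proof.
move=> C_complete oA fA Aa fy.
have [delta [M [d0 M0 fS]]] := analytic2_strict oA fA Aa.
set c := d_x f a in fS; set b := d_y f a in fy fS.
have b0 : 0 < `|b| by rewrite normr_gt0.
have [r r0 rA] := open_box oA Aa.
have M10 : 0 < 2 * (M + 1) by rewrite mulr_gt0 // ltr_wpDl.
(* [rho] is chosen so that the ball lies in [A], the strict estimate holds on it,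
   and [M * rho <= |b| / 2], which gives the ratio 1/2. *)
have [rho1 [rho10 rho1d rho1r]] := exists_pos_le2 d0 (divr_gt0 r0 (ltr0n C 2)).
have [rho [rho0 rho1_le rhob]] := exists_pos_le2 rho10 (divr_gt0 b0 M10).
have rhod := le_trans rho1_le rho1d.
have rho_r : rho < r.
  apply: le_lt_trans (le_trans rho1_le rho1r) _.
  by rewrite ltr_pdivrMr // ltr_pMr // ltr1n.
have Mrho : M * rho <= `|b| / 2.
  move: rhob; rewrite ler_pdivlMr // ler_pdivlMr //; apply: le_trans.
  rewrite (_ : rho * (2 * (M + 1)) = M * rho * 2 + 2 * rho); last by ring.
  by rewrite lerDl mulr_ge0 // ltW.
have N0 : 0 < 2 * (`|c| + M * rho + 1).
  by rewrite mulr_gt0 // ltr_wpDl // addr_ge0 // mulr_ge0 // ltW.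
(* [xi] is small enough for the first step to have length at most [rho / 2]. *)
have [xi [xi0 xirho xib]] := exists_pos_le2 rho0 (divr_gt0 (mulr_gt0 rho0 b0) N0).
have nxi : `|xi| = xi by rewrite ger0_norm // ltW.
pose P y : C * C := (a.1 + xi, a.2 + y).
have AP y : `|y| <= rho -> A (P y).
  move=> yr; apply: rA; rewrite /= addrC addKr ?nxi.
    exact: le_lt_trans xirho rho_r.
  exact: le_lt_trans yr rho_r.
pose phi y := f (P y) - f a.
have phi_lip y y' : `|y| <= rho -> `|y'| <= rho ->
    `|phi y - phi y' - b * (y - y')| <= `|b| / 2 * `|y - y'|.
  move=> yr yr'.
  have := fS rho `|y - y'| (P y) (P y') (AP _ yr) (AP _ yr') rhod.
  rewrite /= subrr normr0 mulr0 add0r.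
  rewrite ![_ + _ - a.1]addrC ![_ + _ - a.2]addrC !addKr nxi.
  have -> : a.2 + y - (a.2 + y') = y - y' by ring.
  move=> /(_ xirho yr xirho yr' (normr_ge0 _) (lexx _)).
  have -> : phi y - phi y' = f (P y) - f (P y') by rewrite /phi; ring.
  move=> /le_trans; apply; rewrite mulrA ler_wpM2r //.
have phi0 : `|phi 0| <= rho * `|b| / 2.
  have z0 : `|0 : C| <= rho by rewrite normr0 ltW.
  have := fS rho xi (P 0) a (AP _ z0) Aa rhod.
  rewrite /= !subrr normr0 addr0 subrr normr0 mulr0 addr0.
  rewrite [_ + _ - a.1]addrC addKr nxi.
  move=> /(_ xirho (ltW rho0) (ltW rho0) (ltW rho0) (lexx _) (ltW xi0)) H.
  rewrite -(subrK (c * xi) (phi 0)).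
  apply: (le_trans (ler_normD _ _)); apply: (le_trans (lerD H (lexx _))).
  rewrite normrM nxi; move: xib; rewrite !ler_pdivlMr //; apply: le_trans.
  rewrite (_ : xi * _ = (M * (rho * xi) + `|c| * xi) * 2 + 2 * xi); last by ring.
  by rewrite lerDl mulr_ge0 // ltW.
pose T y := y - phi y / b.
have T_lip y y' : `|y| <= rho -> `|y'| <= rho -> `|T y - T y'| <= 2^-1 * `|y - y'|.
  move=> yr yr'.
  have -> : T y - T y' = - ((phi y - phi y' - b * (y - y')) / b).
    by rewrite /T; field.
  rewrite normrN normrM normfV ler_pdivrMr //.
  apply: (le_trans (phi_lip _ _ yr yr')).
  by rewrite le_eqVlt; apply/orP; left; apply/eqP; ring.
have T0 : `|T 0| <= rho / 2.
  by rewrite /T sub0r normrN normrM normfV ler_pdivrMr // mulrAC.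
have T_ball y : `|y| <= rho -> `|T y| <= rho.
  move=> yr; rewrite -(subrK (T 0) (T y)); apply: (le_trans (ler_normD _ _)).
  have -> : rho = rho / 2 + rho / 2 by field.
  apply: lerD => //; apply: (le_trans (T_lip _ _ yr _)).
    by rewrite normr0 ltW.
  by rewrite subr0 mulrC ler_wpM2r.
pose y n := iter n T 0.
have y_ball n : `|y n| <= rho.
  by elim: n => [|n IH]; [rewrite /= normr0 ltW | exact: T_ball].
have y_step n : `|y n.+1 - y n| <= rho * 2^-1 ^+ n.
  elim: n => [|n IH]; first by rewrite subr0 mulr1; exact: (y_ball 1%N).
  apply: (le_trans (T_lip (y n.+1) (y n) (y_ball _) (y_ball _))).
  by rewrite exprS mulrCA ler_wpM2l.
have [l yl] := C_complete _ _ y_step.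
have l_ball : `|l| <= rho.
  apply: (norm_lim_le (b := cst rho) yl); first exact: cvg_cst.
  by apply: nearW => n; exact: y_ball.
have Tl : T l = l.
  apply/eqP; rewrite -subr_eq0 -normr_le0.
  have y1l : (fun n => y n.+1) @ \oo --> l by rewrite (cvg_shiftS y).
  apply: (norm_lim_le (G := \oo) (u := fun n => T l - y n.+1)
    (b := fun n => 2^-1 * `|l - y n|)).
  - by apply: cvgB => //; exact: cvg_cst.
  - apply: cvg0Ml; apply: cvg0_norm; rewrite -(subrr l).
    by apply: cvgB => //; exact: cvg_cst.
  by apply: nearW => n; exact: T_lip.
exists (P l); split; first exact: AP.
  apply/eqP => /(congr1 fst) /= /eqP.
  by rewrite -[X in _ == X]addr0 (inj_eq (addrI _)) gt_eqF.
have /eqP : phi l / b = 0.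
  have : T l - l = 0 by rewrite Tl subrr.
  by rewrite /T addrAC subrr add0r => /eqP; rewrite oppr_eq0 => /eqP.
by rewrite mulf_eq0 invr_eq0 (negbTE fy) orbF subr_eq0 => /eqP.
Qed.

(** * Leaves and the transport of slopes *)

Lemma clos_rt_first_step (T : Type) (r : T -> T -> Prop) x y :
  clos_refl_trans T r x y -> x = y \/ exists x', r x x'.
Proof.
by elim=> [x1 y1 xy|x1|x1 y1 z1 _ IH1 _ IH2];
  [right; exists y1 | left | case: IH1 => [->|]; [exact: IH2 | right]].
Qed.

Lemma leafS (C : numClosedFieldType) (A B : set (C * C)) (p : C * C -> C) q :
  A `<=` B -> leaf A p q `<=` leaf B p q.
Proof.
move=> AB q'; elim=> [x y [c [r [u [iu xb yb xu yu]]]]|x|x y z _ IH1 _ IH2].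
- apply: rt_step; exists c, r, u; split => // t /iu[At du]; split => //.
  exact: AB.
- exact: rt_refl.
- exact: rt_trans IH1 IH2.
Qed.

Section Transport.
Variable C : numClosedFieldType.
Hypothesis C_complete : geometric_complete C.

(** The leaf of [q] is a level set, hence contains a point other than [q]; the
    first link of a chain of integral curves from [q] to that point passes
    through [q]. *)
Lemma integral_curve_through (U : set (C * C)) p F q : open U ->
  foliation_function U p F -> U q ->
  exists c r u, [/\ integral_curve U p c r u, ball c r q.1 & q.2 = u q.1].
Proof.
move=> oU [Fan Fy _ Flev] Uq.
have [z [Uz zq Fz]] := level_set_not_isolated C_complete oU Fan Uq (Fy q Uq).
have qz : leaf U p q z by rewrite -(Flev q Uq).
have [{}qz|[q' [c [r [u [iu qb _ qu _]]]]]] := clos_rt_first_step qz.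
  by rewrite qz eqxx in zq.
by exists c, r, u.
Qed.

Lemma parameter_line_proper (K : set C) : parameter_line K ->
  ProperFilter (within K (0 : C)^').
Proof.
move=> Kl; apply: Build_ProperFilter_ex => P.
move=> /nbhs_ballP[r /= r0 rP]; exists (r / 2).
have r2 : 0 < r / 2 by rewrite divr_gt0.
apply: rP.
- rewrite -ball_normE /= sub0r normrN gtr0_norm //.
  by rewrite ltr_pdivrMr // ltr_pMr // ltr1n.
- by rewrite gt_eqF.
- by case: Kl => -> //=; exact: gtr0_real.
Qed.

Lemma within_punctured (K : set C) : within K (0 : C)^' `=>` (0 : C)^'.
Proof. exact: cvg_within. Qed.

Section group.
Variables (K : set C) (U : set (C * C)) (D : set (C * (C * C))).
Variable g : C -> C * C -> C * C.
Hypothesis gG : local_group K U D g.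

Lemma domain_at_open (e : C) : open (domain_at D e).
Proof.
rewrite openE => q De; have [Ke _] := lgroup_sub gG De.
have slice : (fun z : C * C => (e, z)) @ q --> (e, q).
  have l1 : (fun=> e) @ q --> e by exact: cvg_cst.
  have l2 : id @ q --> q by exact: cvg_id.
  exact: (cvg_pair l1 l2).
have near_q : nbhs q [set z | K e -> D (e, z)] := slice _ (lgroup_open gG De).
by apply: filterS near_q => z /(_ Ke).
Qed.

Lemma near_domain_at q : D (0, q) -> \forall e \near within K (0 : C)^', D (e, q).
Proof.
move=> D0; have slice : (fun e : C => (e, q)) @ nbhs (0 : C) --> ((0 : C), q).
  have l1 : (fun e : C => e) @ nbhs (0 : C) --> (0 : C) by move=> B.
  have l2 : (fun=> q) @ nbhs (0 : C) --> q by exact: cvg_cst.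
  exact: (cvg_pair l1 l2).
have near_0 : nbhs (0 : C) [set e | K e -> D (e, q)] := slice _ (lgroup_open gG D0).
exact: cvg_within near_0.
Qed.

Lemma slice_analytic1 e : analytic2_on (domain_at D e) (fun z => (g e z).1).
Proof. exact: (analytic3_slice (e := e) (lgroup_analytic1 gG)). Qed.

Lemma slice_analytic2 e : analytic2_on (domain_at D e) (fun z => (g e z).2).
Proof. exact: (analytic3_slice (e := e) (lgroup_analytic2 gG)). Qed.

Lemma derive_lgroup_id (v q : C * C) : U q ->
  'D_v (fun z => (g 0 z).1) q = v.1 /\ 'D_v (fun z => (g 0 z).2) q = v.2.
Proof.
move=> Uq; have near_id : \forall t \near (0 : C)^', g 0 (t *: v + q) = t *: v + q.
  have Dq := lgroup_dom0 gG Uq.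
  have : \forall t \near (0 : C)^', D (0, t *: v + q).
    apply: (@line_cvg C q v (domain_at D 0)); apply: open_nbhs_nbhs.
    by split => //; exact: domain_at_open.
  by apply: filterS => t /(lgroup_sub gG)[_ Ut]; exact: (lgroup_id gG).
have lim_id := @line_quotient_cvg C q v.
split; apply: cvg_lim; try exact: norm_hausdorff.
- apply: cvg_trans (cvg_fst_comp lim_id); apply: near_eq_cvg.
  by apply: filterS near_id => t /= ->; rewrite (lgroup_id gG Uq).
- apply: cvg_trans (cvg_snd_comp lim_id); apply: near_eq_cvg.
  by apply: filterS near_id => t /= ->; rewrite (lgroup_id gG Uq).
Qed.

Variables (d : nat) (p F : 'I_d -> C * C -> C).
Hypothesis Uopen : open U.
Hypothesis pF : forall i, foliation_function U (p i) (F i).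
Hypothesis gp : preserves_web D g p.

(** The integral curve [u] through [q] stays, for small times, in the domain of
    [g_e]; its image lies in a leaf of the [j]-th foliation, on which [F_j] is
    constant. The derivative of [F_j] along the image at time [0] vanishes, and
    [p_j = - d_x F_j / d_y F_j] turns this into the stated equality. *)
Lemma transported_slope (i : 'I_d) (q : C * C) (e : C) : D (e, q) ->
  exists j : 'I_d, 'D_(1, p i q) (fun z => (g e z).2) q =
    p j (g e q) * 'D_(1, p i q) (fun z => (g e z).1) q.
Proof.
move=> De; have [Ke Uq] := lgroup_sub gG De.
have [j gj] := gp i De; exists j.
have UQ := lgroup_range gG De.
have [c [r [u [iu qb qu]]]] := integral_curve_through Uopen (pF i) Uq.
pose w : C * C := (1, p i q).
pose gam (t : C) : C * C := (t + q.1, u (t + q.1)).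
have id0 : (fun t : C => t) @ (0 : C)^' --> (0 : C).
  by move=> B B0; exact: cvg_within B0.
have gamq : gam 0 = q by rewrite /gam add0r -qu -surjective_pairing.
have dgam : (fun t => t^-1 *: (gam t - q)) @ (0 : C)^' --> w.
  have [_ [du dv]] := iu _ qb.
  have du1 : (fun t => t^-1 *: (u (t + q.1) - u q.1)) @ (0 : C)^' --> p i q.
    move: du; rewrite /derivable => /cvg_ex[l Hl].
    have lE : l = p i q.
      rewrite [q in RHS]surjective_pairing qu -dv; apply/esym.
      exact: (cvg_lim (@norm_hausdorff _ C) Hl).
    rewrite -lE; apply: cvg_trans Hl; apply: near_eq_cvg; apply: nearW => t.
    by rewrite /= [t *: 1]mulr1.
  have d1 : (fun t => t^-1 * (t + q.1 - q.1)) @ (0 : C)^' --> (1 : C).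
    apply: (@cvg_trans _ (cst (1 : C) @ (0 : C)^')); last exact: cvg_cst.
    apply: near_eq_cvg; apply: filterS (nbhs_dnbhs_neq (0 : C)) => t t0.
    by rewrite /= addrK mulVf.
  rewrite -qu in du1; exact: (cvg_pair d1 du1).
have gam_cvg : gam @ (0 : C)^' --> q.
  have : (fun t => t *: (t^-1 *: (gam t - q)) + q) @ (0 : C)^' --> 0 *: w + q.
    by apply: cvgD; [exact: cvgZ | exact: cvg_cst].
  rewrite scale0r add0r; apply: cvg_trans; apply: near_eq_cvg.
  apply: filterS (nbhs_dnbhs_neq (0 : C)) => t t0.
  by rewrite /= scalerA divff // scale1r subrK.
(* Convergence at punctured times extends to time 0, where the curve is at [q]. *)
have [s s0 sP] : exists2 s : C, 0 < s & forall t, `|t| < s ->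
    D (e, gam t) /\ ball c r (t + q.1).
  have D_near : \forall t \near (0 : C)^', D (e, gam t).
    apply: (gam_cvg (domain_at D e)); apply: open_nbhs_nbhs.
    by split => //; exact: domain_at_open.
  have b_near : \forall t \near (0 : C)^', ball c r (t + q.1).
    have tq : (fun t => t + q.1) @ (0 : C)^' --> q.1.
      by have := [elaborate cvgD id0 (cvg_cst q.1)]; rewrite add0r.
    apply: (tq (ball c r)); apply: open_nbhs_nbhs; split => //; exact: ball_open.
  have /nbhs_ballP[s /= s0 sP] : nbhs (0 : C)
      [set t | t != 0 -> D (e, gam t) /\ ball c r (t + q.1)].
    exact: filterI D_near b_near.
  exists s => // t ts; have [->|t0] := eqVneq t 0; first by rewrite gamq add0r.
  by apply: sP => //; rewrite -ball_normE /= sub0r normrN.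
have F_const t : `|t| < s -> F j (g e (gam t)) = F j (g e q).
  move=> ts.
  have gam_leaf : leaf (domain_at D e) (p i) q (gam t).
    apply: rt_step; exists q.1, s, u.
    have b_s t' : ball q.1 s t' -> `|t' - q.1| < s by rewrite -ball_normE /= distrC.
    have tb : ball q.1 s (gam t).1.
      by rewrite -ball_normE /= opprD addrA addrAC subrr sub0r normrN.
    split => //; last exact: ballxx.
    move=> t' /b_s /sP[]; rewrite /gam subrK => Dt bt; split => //.
    by have [] := iu _ bt.
  have : (g e @` leaf (domain_at D e) (p i) q) (g e (gam t)) by exists (gam t).
  rewrite gj => /(leafS (B := U)).
  have DU : domain_at D (- e) `<=` U by move=> z /(lgroup_sub gG)[].
  move=> /(_ DU); have [_ _ _ Flev] := pF j; rewrite -(Flev _ UQ).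
  by case.
pose V1 := 'D_w (fun z => (g e z).1) q; pose V2 := 'D_w (fun z => (g e z).2) q.
have v1 : (fun t => t^-1 * ((g e (gam t)).1 - (g e q).1)) @ (0 : C)^' --> V1.
  rewrite /V1 (analytic2_derive w (@domain_at_open e) (@slice_analytic1 e) De).
  exact: (analytic2_chain (fun _ H => H) (@domain_at_open e)
    (@slice_analytic1 e) De dgam).
have v2 : (fun t => t^-1 * ((g e (gam t)).2 - (g e q).2)) @ (0 : C)^' --> V2.
  rewrite /V2 (analytic2_derive w (@domain_at_open e) (@slice_analytic2 e) De).
  exact: (analytic2_chain (fun _ H => H) (@domain_at_open e)
    (@slice_analytic2 e) De dgam).
have v12 : (fun t => t^-1 *: (g e (gam t) - g e q)) @ (0 : C)^' --> (V1, V2).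
  exact: cvg_pair v1 v2.
have [Fan Fy Fslope _] := pF j.
have Flim := [elaborate analytic2_chain (fun _ H => H) Uopen Fan UQ v12].
have F0 : d_x (F j) (g e q) * V1 + d_y (F j) (g e q) * V2 = 0.
  apply: (cvg_unique (@norm_hausdorff _ C) Flim).
  apply: (@cvg_trans _ (cst (0 : C) @ (0 : C)^')); last exact: cvg_cst.
  apply: near_eq_cvg; have /cvgr0Pnorm_lt /(_ s s0) ts := id0.
  by apply: filterS ts => t ts; rewrite /= F_const // subrr mulr0.
rewrite -/w -/V1 -/V2 (Fslope _ UQ); apply: (mulfI (Fy _ UQ)).
move/eqP: F0; rewrite addrC addr_eq0 => /eqP ->.
by field; exact: Fy.
Qed.
End group.
End Transport.

(** * The determining equation *)

Lemma determining_equation (C : numClosedFieldType)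
    (K : set C) (U : set (C * C)) (D : set (C * (C * C)))
    (g : C -> C * C -> C * C) (d : nat) (p F : 'I_d -> C * C -> C)
    (alpha1 alpha2 : C * C -> C) :
  geometric_complete C -> parameter_line K -> open U ->
  local_group K U D g -> preserves_web D g p ->
  (forall i, foliation_function U (p i) (F i)) ->
  (forall i, analytic2_on U (p i)) ->
  (forall i j, i != j -> forall q, U q -> p i q != p j q) ->
  infinitesimal_generator K U g alpha1 alpha2 ->
  forall i q, U q ->
    - alpha1 q * d_x (p i) q - alpha2 q * d_y (p i) q + d_x alpha2 q
    + (d_y alpha2 q - d_x alpha1 q) * p i q - d_y alpha1 q * p i q ^+ 2 = 0.
Proof.
move=> C_complete Kl Uo gG gp pF pU p_distinct [a1U a2U gen] i q Uq.
have GP := parameter_line_proper Kl.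
have G0 := @within_punctured C K.
set G := within K (0 : C)^' in GP G0.
have Dq := lgroup_dom0 gG Uq.
pose w : C * C := (1, p i q).
pose V1 (e : C) : C := 'D_w (fun z => (g e z).1) q.
pose V2 (e : C) : C := 'D_w (fun z => (g e z).2) q.
have [V10 V20] : V1 0 = 1 /\ V2 0 = p i q := derive_lgroup_id gG w Uq.
have gen_at z : D (0, z) ->
    (fun e => e^-1 *: (g e z - g 0 z)) @ G --> (alpha1 z, alpha2 z).
  move=> /(lgroup_sub gG)[_ Uz]; rewrite (lgroup_id gG Uz); exact: gen.
have dV1 : (fun e => e^-1 * (V1 e - 1)) @ G --> 'D_w alpha1 q.
  rewrite -V10.
  apply: (@mixed_derivative C G GP G0 D (fun z => (g z.1 z.2).1) alpha1
    (domain_at_open gG) (near_domain_at gG) (lgroup_analytic1 gG)) Dq => z /gen_at.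
  exact: cvg_fst_comp.
have dV2 : (fun e => e^-1 * (V2 e - p i q)) @ G --> 'D_w alpha2 q.
  rewrite -V20.
  apply: (@mixed_derivative C G GP G0 D (fun z => (g z.1 z.2).2) alpha2
    (domain_at_open gG) (near_domain_at gG) (lgroup_analytic2 gG)) Dq => z /gen_at.
  exact: cvg_snd_comp.
have V1_lim := [elaborate quotient_cvg G0 dV1].
have V2_lim := [elaborate quotient_cvg G0 dV2].
have dp j : (fun e => e^-1 * (p j (g e q) - p j q)) @ G -->
    d_x (p j) q * alpha1 q + d_y (p j) q * alpha2 q.
  exact: (analytic2_chain G0 Uo (pU j) Uq (gen q Uq)).
have p_lim j := [elaborate quotient_cvg G0 (dp j)].
(* For [j != i] the limit is [p_i q - p_j q], which is nonzero. *)
have other_slopes : \forall e \near G, forall j,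
    j != i -> V2 e - p j (g e q) * V1 e != 0.
  apply: filter_forall => j; have [->|ji] := eqVneq j i.
    by apply: nearW => e.
  have lim_j : (fun e => V2 e - p j (g e q) * V1 e) @ G --> p i q - p j q * 1.
    exact: (cvgB V2_lim (cvgM (p_lim j) V1_lim)).
  apply: filterS (cvgr_neq0 _ lim_j _); first by move=> e.
  by rewrite mulr1 subr_eq0 p_distinct // eq_sym.
have same_slope : \forall e \near G, V2 e = p i (g e q) * V1 e.
  apply: filterS2 (near_domain_at gG Dq) other_slopes => e De Hj.
  have [j Vj] := transported_slope C_complete gG Uo pF gp i De.
  have [<- //|ji] := eqVneq j i.
  by have := Hj j ji; rewrite /V2 Vj subrr eqxx.
(* The derivative of [V2] at 0 again, now as that of [p_i (g_e q) * V1]. *)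
have dV2' : (fun e => e^-1 * (V2 e - p i q)) @ G -->
    (d_x (p i) q * alpha1 q + d_y (p i) q * alpha2 q) * 1 + p i q * 'D_w alpha1 q.
  have := [elaborate cvgD (cvgM (dp i) V1_lim) (cvgM (cvg_cst (p i q)) dV1)].
  apply: cvg_trans; apply: near_eq_cvg; apply: filterS same_slope => e Ve.
  rewrite Ve (_ : e^-1 * _ = e^-1 * (p i (g e q) - p i q) * V1 e +
    p i q * (e^-1 * (V1 e - 1))) //; ring.
have := cvg_unique (@norm_hausdorff _ C) dV2 dV2'.
rewrite (analytic2_derive w Uo a1U Uq) (analytic2_derive w Uo a2U Uq) /= !mulr1.
set rhs := (X in _ = X) => slope_eq.
by rewrite -[RHS](subrr rhs) -{1}slope_eq /rhs; ring.
Qed.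

End Web.

Theorem mainTheorem1 (R : realType) (d : nat) (U : set (Cplx R * Cplx R))
    (a : 'I_d.+1 -> Cplx R * Cplx R -> Cplx R)
    (p F : 'I_d -> Cplx R * Cplx R -> Cplx R)
    (web : implicit_web U a p F)
    (K : set (Cplx R)) (K_line : parameter_line K)
    (D : set (Cplx R * (Cplx R * Cplx R)))
    (g : Cplx R -> Cplx R * Cplx R -> Cplx R * Cplx R)
    (sym : symmetry_group K U D g p)
    (alpha1 alpha2 : Cplx R * Cplx R -> Cplx R)
    (gen : infinitesimal_generator K U g alpha1 alpha2) :
  forall (i : 'I_d) (q : Cplx R * Cplx R), U q ->
    - alpha1 q * d_x (p i) q - alpha2 q * d_y (p i) q + d_x alpha2 q
    + (d_y alpha2 q - d_x alpha1 q) * p i q - d_y alpha1 q * p i q ^+ 2 = 0.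
Proof.
have [gG gp] := sym.
exact: (determining_equation (@Cplx_geometric_complete R) K_line (web_open web)
  gG gp (web_foliation web) (web_slope_analytic web) (web_slope_distinct web) gen).
Qed.
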